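(* Let $(\Omega,\mathcal{F},P_0)$ be a complete probability space, $\epsilon\in(0,1)$, $\mathcal{C}\subseteq\mathcal{F}$ a sub-$\sigma$-algebra, and $\rho$ a sublinear operator on $L^{2+\epsilon}_{\mathcal{F}}(\Omega,P_0)$ with representation set $\mathcal{P}$, satisfying the standing assumptions below. If $\xi\in L^{4+2\epsilon}_{\mathcal{F}}(\Omega,P_0)$ and $\rho$ is stable, then there exists $\hat\eta\in L^{2+\epsilon}_{\mathcal{C}}(\Omega,P_0)$ such that $$\rho\big((\xi-\hat\eta)^2\big)=\inf_{\eta\in L^{2+\epsilon}_{\mathcal{C}}(P_0)}\rho\big((\xi-\eta)^2\big).$$
   Context: A sublinear operator is a map $\rho:L^{2+\epsilon}_{\mathcal{F}}(\Omega,P_0)\to\mathbb{R}$ that is monotone, constant preserving, sub-additive and positively homogeneous. Its representation set $\mathcal{P}$ is the family of all linear expectations (identified with probability measures $P$) dominated by $\rho$, so $\rho(\xi)=\max_{P\in\mathcal{P}}E_P[\xi]$; for $\xi\in L^{4+2\epsilon}$, $\eta\in L^{2+\epsilon}$, $\rho((\xi-\eta)^2)$ means $\sup_{P\in\mathcal{P}}E_P[(\xi-\eta)^2]$. Write $f^P=dP/dP_0$, $\mathcal{D}=\{f^P:P\in\mathcal{P}\}$. Standing assumptions: every $P\in\mathcal{P}$ is equivalent to $P_0$; $\mathcal{D}$ is norm-bounded in $L^{1+\frac{2}{\epsilon}}_{\mathcal{F}}(P_0)$ and $\sigma(L^{1+\frac{2}{\epsilon}}(P_0),L^{1+\frac{\epsilon}{2}}(P_0))$-compact.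 $\rho$ is stable if for each $P\in\mathcal{P}$ the random variable $f^P/E_{P_0}[f^P\mid\mathcal{C}]$ lies in $\mathcal{D}$. $L^{2+\epsilon}_{\mathcal{C}}(P_0)$ denotes the $\mathcal{C}$-measurable elements of $L^{2+\epsilon}(P_0)$. *)

(* Defs.v *)
From HB Require Import structures.
From mathcomp Require Import all_boot all_order all_algebra.
From mathcomp Require Import all_classical all_reals all_analysis.
Import Order.TTheory GRing.Theory Num.Theory.
Import numFieldNormedType.Exports.

Local Open Scope classical_set_scope.
Local Open Scope ring_scope.

Section defs.
Context {R : realType} {d : measure_display} {T : measurableType d}.

(* f is (a representative of an element) of L^p_F(Omega, P0), p real >= 1 *)
Definition Lp (P0 : {measure set T -> \bar R}) (p : R) (f : T -> R) :=
  measurable_fun setT f /\ finite_norm P0 p%:E f.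

Definition measurable_wrt (C : set (set T)) (f : T -> R) :=
  forall B : set R, measurable B -> C (f @^-1` B).

Definition is_sub_sigma_algebra (C : set (set T)) :=
  sigma_algebra setT C /\ C `<=` measurable.

Definition LpC (P0 : {measure set T -> \bar R}) (C : set (set T)) (p : R) f :=
  Lp P0 p f /\ measurable_wrt C f.

Definition sublinear (P0 : {measure set T -> \bar R}) (p : R) (rho : (T -> R) -> R) :=
  [/\ (forall xi eta, Lp P0 p xi -> Lp P0 p eta ->
         {ae P0, forall x, xi x <= eta x} -> rho xi <= rho eta),
      (forall c : R, rho (cst c) = c),
      (forall xi eta, Lp P0 p xi -> Lp P0 p eta -> rho (xi \+ eta) <= rho xi + rho eta) &
      (forall (l : R) xi, 0 <= l -> Lp P0 p xi -> rho (fun x => l * xi x) = l * rho xi)].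

Definition repset (P0 : {measure set T -> \bar R}) (p : R) (rho : (T -> R) -> R) :
  set (probability T R) :=
  [set P | forall xi, Lp P0 p xi ->
      P.-integrable setT (EFin \o xi) /\ (\int[P]_x (xi x)%:E <= (rho xi)%:E)%E].

Definition equivalent_measures (P Q : {measure set T -> \bar R}) :=
  forall A, measurable A -> (P A = 0%E <-> Q A = 0%E).

Definition is_density (P0 P : {measure set T -> \bar R}) (h : T -> R) :=
  [/\ measurable_fun setT h, (forall x, 0 <= h x) &
      forall A, measurable A -> P A = (\int[P0]_(x in A) (h x)%:E)%E].

Definition densities (P0 : {measure set T -> \bar R}) (Pset : set (probability T R)) :
  set (T -> R) := [set h | exists2 P, Pset P & is_density P0 P h].

Definition cond_exp_version (P0 : {measure set T -> \bar R}) (C : set (set T))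
  (f g : T -> R) :=
  [/\ measurable_wrt C g, P0.-integrable setT (EFin \o g) &
      forall A, C A -> (\int[P0]_(x in A) (g x)%:E = \int[P0]_(x in A) (f x)%:E)%E].

(* index set of the weak topology sigma(L^q, L^{q'}) *)
Definition Ltest (P0 : {measure set T -> \bar R}) (q' : R) :=
  {g : T -> R | Lp P0 q' g}.

Definition pairing (P0 : {measure set T -> \bar R}) (q' : R) (f : T -> R) :
  {ptws Ltest P0 q' -> R} :=
  fun g => fine (\int[P0]_x (f x * sval g x)%:E)%E.

Definition weakly_compact (P0 : {measure set T -> \bar R}) (q' : R) (A : set (T -> R)) :=
  @compact (initial_topology (pairing P0 q')) A.

Definition stable (P0 : {measure set T -> \bar R}) (C : set (set T))
  (Pset : set (probability T R)) :=
  forall P, Pset P -> forall f, is_density P0 P f ->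
    exists g, cond_exp_version P0 C f g /\ densities P0 Pset (fun x => f x / g x).

(* rho((xi - eta)^2) := sup_{P in Pset} E_P[(xi - eta)^2] *)
Definition rho_sq (Pset : set (probability T R)) (xi eta : T -> R) : \bar R :=
  ereal_sup [set (\int[P]_x (((xi x - eta x) ^+ 2)%:E))%E | P in Pset].

End defs.

(* Main.v *)
(* For a density f of a measure in the representation set, let J(f) be the
   infimum over eta of E[f (xi - eta)^2].  Each f |-> E[f (xi - eta)^2] is
   weakly continuous, so J attains its maximum on the weakly compact set of
   densities, at some fh.  The minimiser for a density f is the conditional mean
   a / u, where u = E[f | C] and a = E[xi f | C]; stability puts f / u in
   L^{1+2/eps}, and since f / u has conditional expectation 1, Young's inequality
   x y^3 <= x^4 / 4 + 3 y^4 / 4 gives E[(a / u)^4] <= E[(f / u) xi^4], so that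
   a / u is in L^4, hence in L^{2+eps}.
   Let mh be the conditional mean of fh, f another density, and m_t the
   conditional mean of (1 - t) fh + t f, which is explicit.  From
   J((1 - t) fh + t f) <= J(fh) one gets E[f (xi - m_t)^2] <= J(fh), and Fatou's
   lemma as t -> 0 gives E[f (xi - mh)^2] <= J(fh): mh is optimal. *)
From HB Require Import structures.
From mathcomp Require Import all_boot all_order all_algebra.
From mathcomp Require Import all_classical all_reals all_analysis.
From mathcomp Require Import measurable_realfun lra ring.
Require Import Defs.
Import Order.TTheory GRing.Theory Num.Theory.
Import numFieldNormedType.Exports.
Local Open Scope classical_set_scope.
Local Open Scope ring_scope.

Set Implicit Arguments.
Unset Strict Implicit.

(** * Measures given by a density *)

Section density_measure.
Context {d : measure_display} {T : measurableType d} {R : realType}.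
Context (mu : {measure set T -> \bar R}) {h : T -> R}.
Context (mh : measurable_fun setT h) (h0 : forall x, 0 <= h x).

(** The two proofs are arguments so that the measure structure, which depends on them, can be
    attached to this set function. *)
Definition density_measure of measurable_fun setT h & (forall x, 0 <= h x) :=
  fun A : set T => (\int[mu]_(x in A) (h x)%:E)%E.

Let density0 : density_measure mh h0 set0 = 0%E.
Proof. exact: integral_set0. Qed.

Let density_ge0 A : (0 <= density_measure mh h0 A)%E.
Proof. by apply: integral_ge0 => x _; rewrite lee_fin. Qed.

Let density_sigma_additive : semi_sigma_additive (density_measure mh h0).
Proof.
apply: semi_sigma_additive_nng_induced; first exact/measurable_EFinP.
by move=> x; rewrite lee_fin.
Qed.

HB.instance Definition _ := isMeasure.Build d T R (density_measure mh h0)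
  density0 density_ge0 density_sigma_additive.

Lemma density_measure_density : is_density mu (density_measure mh h0) h.
Proof. by split. Qed.

End density_measure.

Section densities.
Context {d : measure_display} {T : measurableType d} {R : realType}.
Context (mu : {sigma_finite_measure set T -> \bar R}).

(** The Radon-Nikodym derivative obtained here is finite everywhere, so [fine] makes it a real
    density without changing any integral. *)
Lemma density_exists (nu : {finite_measure set T -> \bar R}) :
  nu `<< mu -> exists h, is_density mu nu h.
Proof.
move=> numu.
have [f [f0 ffin fint fE]] := radon_nikodym_sigma_finite numu.
exists (fine \o f); split=> [|x|A mA] /=.
- exact: measurableT_comp (measurable_int _ fint).
- exact: fine_ge0.
- by rewrite fE//; apply: eq_integral => x _; rewrite fineK.
Qed.

Lemma density_integrable (nu : {finite_measure set T -> \bar R}) (h : T -> R) :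
  is_density mu nu h -> mu.-integrable setT (EFin \o h).
Proof.
move=> [mh h0 hE]; apply/integrableP; split; first exact/measurable_EFinP.
under eq_integral do rewrite /= ger0_norm//.
by rewrite -hE// ltey_eq fin_num_measure.
Qed.

Lemma density_dominates (nu : {finite_measure set T -> \bar R}) (h : T -> R) :
  is_density mu nu h -> nu `<< mu.
Proof.
move=> [mh h0 hE]; apply/null_content_dominatesP => A mA A0.
rewrite hE//; apply: null_set_integral => //.
by apply/measurable_EFinP/measurable_funTS.
Qed.

(** Change of variables holds for the Radon-Nikodym derivative; [h] has the same integral over every
    measurable set, hence equals it almost everywhere. *)
Lemma ge0_integral_density (nu : {finite_measure set T -> \bar R}) (h : T -> R)
    (f : T -> \bar R) :
  is_density mu nu h -> measurable_fun setT f -> (forall x, 0 <= f x)%E ->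
  (\int[nu]_x f x = \int[mu]_x (f x * (h x)%:E))%E.
Proof.
move=> hd mf f0; have numu := density_dominates hd.
have hi := density_integrable hd; case: hd => mh h0 hE.
rewrite -(Radon_Nikodym_SigmaFinite.change_of_variables numu)//.
have mrn := measurable_int _ (Radon_Nikodym_SigmaFinite.f_integrable numu).
apply: ae_eq_integral => //.
- exact: emeasurable_funM.
- by apply: emeasurable_funM => //; exact/measurable_EFinP.
- apply: ae_eqe_mul2l; apply: integral_ae_eq => //.
  + exact: Radon_Nikodym_SigmaFinite.f_integrable.
  + exact/measurable_EFinP.
  + by move=> A _ mA; rewrite -Radon_Nikodym_SigmaFinite.f_integral// hE.
Qed.

End densities.

(** * Conditional expectation through restriction to a sub-sigma-algebra *)

Section sub_sigma_algebra.
Context {d : measure_display} {T : measurableType d} {R : realType}.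
Context {P0 : probability T R} {C : set (set T)} (hC : is_sub_sigma_algebra C).

Local Notation TC := (g_sigma_algebraType C).
Local Notation intg f := (P0.-integrable setT (EFin \o f)).

(** [TC] is [T] carrying [C] as its sigma-algebra. Pushing a measure forward along this identity
    restricts it to [C], so that conditioning becomes a matter of measures on [TC]. *)
Lemma sub_sigma_measurable_id : measurable_fun setT (id : T -> TC).
Proof.
move=> _ A; rewrite measurable_g_measurableTypeE; last exact: hC.1.
by rewrite setTI; exact: hC.2.
Qed.

Lemma measurable_wrtP (f : T -> R) :
  measurable_wrt C f <-> measurable_fun setT (f : TC -> R).
Proof.
have E := measurable_g_measurableTypeE hC.1.
split=> [mf _ B mB | mf B mB].
  by rewrite E setTI; exact: mf.
by have := mf measurableT B mB; rewrite E setTI.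
Qed.

Lemma measurable_wrt_measurable (f : T -> R) :
  measurable_wrt C f -> measurable_fun setT f.
Proof. by move=> mf _ B mB; rewrite setTI; apply/hC.2/mf. Qed.

(** The measures with densities [h] and [k] agree on [C], so their pushforwards to [TC] give [z] the
    same integral. Both sides may be infinite, which later lets integrability pass from one to the
    other. *)
Lemma ge0_integral_sub_sigma (h k z : T -> R) :
  measurable_fun setT h -> (forall x, 0 <= h x) -> intg h ->
  measurable_fun setT k -> (forall x, 0 <= k x) -> intg k ->
  (forall A, C A ->
    (\int[P0]_(x in A) (h x)%:E = \int[P0]_(x in A) (k x)%:E)%E) ->
  measurable_wrt C z -> (forall x, 0 <= z x) ->
  (\int[P0]_x (z x * h x)%:E = \int[P0]_x (z x * k x)%:E)%E.
Proof.
move=> mh h0 hi mk k0 ki hk mz z0.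
have fin (f : T -> R) (mf : measurable_fun setT f) (f0 : forall x, 0 <= f x) : intg f ->
    fin_num_fun (density_measure P0 mf f0).
  move=> fi; apply: lty_fin_num_fun.
  by have := integrable_lty measurableT fi.
pose nh : {finite_measure set T -> \bar R} := HB.pack (density_measure P0 mh h0)
  (Measure_isFinite.Build _ _ _ (density_measure P0 mh h0) (fin _ mh h0 hi)).
pose nk : {finite_measure set T -> \bar R} := HB.pack (density_measure P0 mk k0)
  (Measure_isFinite.Build _ _ _ (density_measure P0 mk k0) (fin _ mk k0 ki)).
have mzT : measurable_fun setT (EFin \o z).
  exact/measurable_EFinP/measurable_wrt_measurable.
have mzC : measurable_fun setT (EFin \o z : TC -> \bar R).
  exact/measurable_EFinP/measurable_wrtP.
have mid := sub_sigma_measurable_id.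
have nE (f : T -> R) (n : {finite_measure set T -> \bar R}) :
    is_density P0 n f ->
    (\int[P0]_x (z x * f x)%:E = \int[pushforward n (id : T -> TC)]_x (z x)%:E)%E.
  move=> nf; rewrite ge0_integral_pushforward//; last first.
    by move=> y _; rewrite lee_fin.
  by rewrite preimage_setT (ge0_integral_density nf)// => x; rewrite lee_fin.
rewrite (nE h nh (density_measure_density P0 mh h0)).
rewrite (nE k nk (density_measure_density P0 mk k0)).
apply: eq_measure_integral => A; rewrite measurable_g_measurableTypeE.
  by move=> CA _; exact: hk.
exact: hC.1.
Qed.

(** Radon-Nikodym on [TC]: the charge with density [h], restricted to [C], is dominated by the
    restriction of [P0], and its derivative is measurable on [TC]. *)
Lemma cond_exp_exists (h : T -> R) : intg h ->
  exists k, cond_exp_version P0 C h k.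
Proof.
move=> hi; have mid := sub_sigma_measurable_id.
have E := measurable_g_measurableTypeE hC.1.
pose idC : {mfun T >-> TC} := HB.pack (id : T -> TC)
  (isMeasurableFun.Build _ _ _ _ _ mid).
pose nu : set TC -> \bar R := pushforward (induced_charge hi) idC.
have numu : nu `<< distribution P0 idC.
  apply/null_content_dominatesP => A mA A0; apply: null_set_integral => //.
    by rewrite -[X in measurable X]setTI; exact: sub_sigma_measurable_id.
  exact/measurable_funTS/(measurable_int _ hi).
have [f [ffin fint fE]] : exists f : TC -> \bar R,
    [/\ forall x, f x \is a fin_num, (distribution P0 idC).-integrable setT f &
    forall A, measurable A -> nu A = (\int[distribution P0 idC]_(x in A) f x)%E].
  exact: charge.Radon_Nikodym0 numu.
have mfC : measurable_fun setT f := measurable_int _ fint.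
have mwf : measurable_wrt C (fine \o f).
  by apply/measurable_wrtP; exact: measurableT_comp mfC.
have fiP : P0.-integrable setT (f \o idC).
  apply/integrableP; split.
    exact: measurableT_comp.
  have /integrableP[_] := fint.
  rewrite ge0_integral_distribution//.
  exact: measurableT_comp.
exists (fine \o f); split=> //.
- by apply: eq_integrable fiP => // x _ /=; rewrite fineK.
- move=> A CA.
  have mA : (measurable : set (set TC)) A by rewrite E.
  rewrite -[RHS]/(nu A) fE// integral_pushforward//.
    by apply: eq_integral => x _ /=; rewrite fineK.
  by apply: (integrableS measurableT) => //; exact: hC.2.
Qed.

End sub_sigma_algebra.

(** * Integrability of real-valued functions *)

Section real_integrable.
Context {d : measure_display} {T : measurableType d} {R : realType}.
Context {mu : {measure set T -> \bar R}}.
Local Notation intg f := (mu.-integrable setT (EFin \o f)).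
Implicit Types f g : T -> R.

Lemma intg_meas f : intg f -> measurable_fun setT f.
Proof. by move/measurable_int/measurable_EFinP. Qed.

Lemma intg_le f g : measurable_fun setT f -> (forall x, `|f x| <= g x) ->
  intg g -> intg f.
Proof.
move=> mf fg; apply: le_integrable => //; first exact/measurable_EFinP.
by move=> x _ /=; rewrite lee_fin (le_trans (fg x))// ler_norm.
Qed.

Lemma intgD f g : intg f -> intg g -> intg (fun x => f x + g x).
Proof. by move=> fi gi; exact: (integrableD measurableT fi gi). Qed.

Lemma intgB f g : intg f -> intg g -> intg (fun x => f x - g x).
Proof. by move=> fi gi; exact: (integrableB measurableT fi gi). Qed.

Lemma intgZ (c : R) f : intg f -> intg (fun x => c * f x).
Proof. by move=> fi; exact: (integrableZl measurableT c fi). Qed.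

Lemma intg_norm f : intg f -> intg (fun x => `|f x|).
Proof. by move=> fi; exact: integrable_norm. Qed.

Lemma intg_ge0P f : measurable_fun setT f -> (forall x, 0 <= f x) ->
  intg f <-> (\int[mu]_x (f x)%:E < +oo)%E.
Proof.
move=> mf f0; split=> [/(integrable_lty measurableT)//|fy].
apply/integrableP; split; first exact/measurable_EFinP.
by under eq_integral do rewrite /= ger0_norm//.
Qed.

Lemma Rintegral_EFin f (A : set T) : measurable A -> intg f ->
  (\int[mu]_(x in A) (f x)%:E = (\int[mu]_(x in A) f x)%:E)%E.
Proof.
move=> mA fi; rewrite fineK//; apply: integrable_fin_num => //.
exact: integrableS fi.
Qed.

End real_integrable.

(** * Conditional expectation against signed factors *)

Section cond_exp.
Context {d : measure_display} {T : measurableType d} {R : realType}.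
Context {P0 : probability T R} {C : set (set T)} (hC : is_sub_sigma_algebra C).
Local Notation intg f := (P0.-integrable setT (EFin \o f)).
Implicit Types h k z : T -> R.

(** Two shifts reduce this to the nonnegative case: [z] is the difference of [|z| + z] and [|z|],
    and adding [s = |h| + |k|] makes both [h] and [k] nonnegative. *)
Lemma cond_exp_Rintegral h k z : intg h -> cond_exp_version P0 C h k ->
  measurable_wrt C z -> intg (fun x => z x * h x) -> intg (fun x => z x * k x) ->
  \int[P0]_x (z x * h x) = \int[P0]_x (z x * k x).
Proof.
move=> hi [mk ki hk].
wlog z0 : z / forall x, 0 <= z x => [nonneg mz zh zk|].
  have mnz : measurable_wrt C (fun x => `|z x|).
    move/(measurable_wrtP hC) : mz => mz.
    by apply/(measurable_wrtP hC); exact: measurableT_comp.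
  have mpz : measurable_wrt C (fun x => `|z x| + z x).
    move/(measurable_wrtP hC) : mz => mz; move/(measurable_wrtP hC) : mnz => mnz.
    by apply/(measurable_wrtP hC); exact: measurable_funD.
  have nzi (f : T -> R) : measurable_fun setT f -> intg (fun x => z x * f x) ->
      intg (fun x => `|z x| * f x).
    move=> mf zf; apply: intg_le (intg_norm zf).
      by apply: measurable_funM => //; exact: (measurable_wrt_measurable hC).
    by move=> x; rewrite !normrM normr_id.
  have mh := intg_meas hi; have mk' := intg_meas ki.
  have pzi (f : T -> R) : measurable_fun setT f -> intg (fun x => z x * f x) ->
      intg (fun x => (`|z x| + z x) * f x).
    move=> mf zf; under eq_fun do rewrite mulrDl.
    by apply: intgD => //; exact: nzi.
  have split_z (f : T -> R) : measurable_fun setT f -> intg (fun x => z x * f x) ->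
     \int[P0]_x (z x * f x) =
     \int[P0]_x ((`|z x| + z x) * f x) - \int[P0]_x (`|z x| * f x).
    move=> mf zf; rewrite -RintegralB//; [|exact: pzi|exact: nzi].
    by apply: eq_Rintegral => x _; ring.
  rewrite !split_z// (nonneg (fun x => `|z x| + z x))//; last 3 first.
  - by move=> x; have := ler_norm (- z x); rewrite normrN; lra.
  - exact: pzi.
  - exact: pzi.
  by rewrite (nonneg (fun x => `|z x|))//; exact: nzi.
move=> mz zh zk.
have mzT := measurable_wrt_measurable hC mz.
have mh := intg_meas hi; have mk' := intg_meas ki.
pose s x := `|h x| + `|k x|.
have si : intg s by apply: intgD; exact: intg_norm.
have zsi : intg (fun x => z x * s x).
  have zhk := intgD (intg_norm zh) (intg_norm zk).
  apply: intg_le zhk; first by apply: measurable_funM => //; exact: intg_meas si.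
  by move=> x; rewrite !normrM ger0_norm// ger0_norm ?addr_ge0// mulrDr.
have key : (\int[P0]_x (z x * (s x + h x))%:E =
            \int[P0]_x (z x * (s x + k x))%:E)%E.
  apply: (ge0_integral_sub_sigma hC) => //.
  - by apply: measurable_funD => //; exact: intg_meas si.
  - by move=> x; rewrite /s; have := ler_norm (- h x); have := normr_ge0 (k x);
      rewrite normrN; lra.
  - exact: intgD.
  - by apply: measurable_funD => //; exact: intg_meas si.
  - by move=> x; rewrite /s; have := ler_norm (- k x); have := normr_ge0 (h x);
      rewrite normrN; lra.
  - exact: intgD.
  - move=> A CA; have mA := hC.2 _ CA.
    have aS (f : T -> R) : intg f -> P0.-integrable A (EFin \o f).
      by move=> fi; exact: integrableS fi.
    have AE (f : T -> R) : intg f -> (\int[P0]_(x in A) (s x + f x)%:E =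
        (\int[P0]_(x in A) s x + \int[P0]_(x in A) f x)%:E)%E.
      move=> fi; rewrite Rintegral_EFin//; last exact: intgD.
      by rewrite RintegralD//; exact: aS.
    by rewrite !AE// /Rintegral hk.
have E (f : T -> R) : intg (fun x => z x * f x) ->
    \int[P0]_x (z x * (s x + f x)) = \int[P0]_x (z x * s x) + \int[P0]_x (z x * f x).
  move=> zf; rewrite -RintegralD//.
  by apply: eq_Rintegral => x _; ring.
apply: (addrI (\int[P0]_x (z x * s x))).
by rewrite -!E// /Rintegral key.
Qed.

End cond_exp.

(** * Spaces L^p over a probability measure *)

Section Lp_theory.
Context {d : measure_display} {T : measurableType d} {R : realType}.
Context {P0 : probability T R}.
Local Notation intg f := (P0.-integrable setT (EFin \o f)).
Implicit Types (f g : T -> R) (p q : R).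

Lemma intg_cst (c : R) : intg (fun=> c).
Proof. exact: finite_measure_integrable_cst. Qed.

Lemma measurable_norm_powR f p :
  measurable_fun setT f -> measurable_fun setT (fun x => `|f x| `^ p).
Proof.
move=> mf; apply: (@measurableT_comp _ _ _ _ _ _ (@powR R ^~ p)) => //.
exact: measurableT_comp.
Qed.

Lemma LpP p f : 0 < p ->
  Lp P0 p f <-> measurable_fun setT f /\ intg (fun x => `|f x| `^ p).
Proof.
move=> p0; have pN0 : p != 0 by rewrite gt_eqF.
have E : (\int[P0]_x (`|f x| `^ p)%:E = 'N[P0]_p%:E[EFin \o f] `^ p)%E.
  by rewrite poweR_Lnorm//; apply: eq_integral => x _ /=; rewrite poweR_EFin.
have mp (mf : measurable_fun setT f) := measurable_norm_powR p mf.
split=> -[mf fN]; split=> //.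
  apply/intg_ge0P; [exact: mp|by move=> x; exact: powR_ge0|].
  by rewrite E poweR_lty.
move: fN => /(intg_ge0P (mp mf) (fun x => powR_ge0 _ _)); rewrite E => Ny.
rewrite /finite_norm; have := poweR_lty p^-1 Ny.
by rewrite -poweRrM mulfV// poweRe1// Lnorm_ge0.
Qed.

Lemma Lp_meas p f : Lp P0 p f -> measurable_fun setT f.
Proof. by case. Qed.

(** The [p]-th power of a maximum is at most the sum of the [p]-th powers. Differences, mixtures and
    quotients below are all bounded by such a maximum. *)
Lemma le_Lp p (c : R) f g1 g2 : 0 < p -> 0 <= c -> measurable_fun setT f ->
  Lp P0 p g1 -> Lp P0 p g2 ->
  (forall x, `|f x| <= c * Num.max `|g1 x| `|g2 x|) -> Lp P0 p f.
Proof.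
move=> p0 c0 mf /(LpP _ p0)[m1 i1] /(LpP _ p0)[m2 i2] fg.
apply/(LpP _ p0); split=> //; have i := intgZ (c `^ p) (intgD i1 i2).
apply: (intg_le _ _ i); first exact: measurable_norm_powR.
move=> x; rewrite ger0_norm ?powR_ge0//.
have m0 : 0 <= Num.max `|g1 x| `|g2 x| by rewrite le_max normr_ge0.
apply: (@le_trans _ _ ((c * Num.max `|g1 x| `|g2 x|) `^ p)).
  by apply: ge0_ler_powR; rewrite ?nnegrE ?(ltW p0)// mulr_ge0.
rewrite powRM//; apply: ler_wpM2l; first exact: powR_ge0.
by case: (leP `|g1 x| `|g2 x|) => _; rewrite ?lerDl ?lerDr powR_ge0.
Qed.

Lemma Lp_cst p (c : R) : 0 < p -> Lp P0 p (cst c).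
Proof. by move=> p0; apply/(LpP _ p0); split=> //; exact: (intg_cst (`|c| `^ p)). Qed.

Lemma LpB p f g : 0 < p -> Lp P0 p f -> Lp P0 p g -> Lp P0 p (fun x => f x - g x).
Proof.
move=> p0 fp gp; apply: (le_Lp p0 _ _ fp gp (c := 2)) => // [|x].
  by apply: measurable_funB; [exact: Lp_meas fp|exact: Lp_meas gp].
apply: (le_trans (ler_normB _ _)).
by case: (leP `|f x| `|g x|) => ?; lra.
Qed.

Lemma le_powR_add1 (a p q : R) : 0 <= a -> 0 <= p <= q -> a `^ p <= 1 + a `^ q.
Proof.
move=> a0 /andP[p0 pq]; have [a1|a1] := leP a 1.
  apply: (@le_trans _ _ 1); last by rewrite lerDl powR_ge0.
  by have := ge0_ler_powR p0 a0 ler01 a1; rewrite powR1; exact.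
apply: (@le_trans _ _ (a `^ q)); last by rewrite lerDr.
by rewrite ler_powR// ltW.
Qed.

Lemma Lp_le p q f : 0 < p <= q -> Lp P0 q f -> Lp P0 p f.
Proof.
move=> /andP[p0 pq]; have q0 : 0 < q by exact: lt_le_trans pq.
move=> /(LpP _ q0)[mf fi]; apply/(LpP _ p0); split=> //.
apply: (intg_le _ _ (intgD (intg_cst 1) fi)); first exact: measurable_norm_powR.
by move=> x; rewrite ger0_norm ?powR_ge0// le_powR_add1// ltW.
Qed.

(** Pointwise, [|f * g|] is at most the square of the larger factor. *)
Lemma Lp_mul p f g : 0 < p -> Lp P0 (2 * p) f -> Lp P0 (2 * p) g ->
  Lp P0 p (fun x => f x * g x).
Proof.
move=> p0; have p20 : 0 < 2 * p by rewrite mulr_gt0.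
move=> /(LpP _ p20)[mf fi] /(LpP _ p20)[mg gi]; apply/(LpP _ p0).
have mfg : measurable_fun setT (fun x => f x * g x) by exact: measurable_funM.
split=> //; apply: (intg_le _ _ (intgD fi gi)); first exact: measurable_norm_powR.
move=> x; rewrite ger0_norm ?powR_ge0// normrM !powRrM !powR_mulrn//.
have h (a b : R) : 0 <= a -> a <= b -> (a * b) `^ p <= (b ^+ 2) `^ p.
  move=> a0 ab; apply: ge0_ler_powR; rewrite ?nnegrE ?(ltW p0)//.
  - by rewrite mulr_ge0// (le_trans a0).
  - exact: exprn_ge0 (le_trans a0 ab).
  - by rewrite expr2; apply: ler_wpM2r => //; exact: le_trans ab.
have [fg|/ltW gf] := leP `|f x| `|g x|.
  by apply: (le_trans (h _ _ _ fg)) => //; rewrite lerDr powR_ge0.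
by rewrite mulrC; apply: (le_trans (h _ _ _ gf)) => //; rewrite lerDl powR_ge0.
Qed.

Lemma Lp_conj_intg p q f g : 0 < p -> 0 < q -> p^-1 + q^-1 = 1 ->
  Lp P0 p f -> Lp P0 q g -> intg (fun x => f x * g x).
Proof.
move=> p0 q0 pq /(LpP _ p0)[mf fi] /(LpP _ q0)[mg gi].
apply: (intg_le _ _ (intgD (intgZ p^-1 fi) (intgZ q^-1 gi))).
  exact: measurable_funM.
move=> x; rewrite normrM mulrC [in leRHS]mulrC [X in _ <= _ + X]mulrC mulrC.
exact: conjugate_powR.
Qed.

End Lp_theory.

(** * Passing a uniform bound to a pointwise limit *)

Section fatou_bound.
Context {d : measure_display} {T : measurableType d} {R : realType}.
Context {mu : {measure set T -> \bar R}}.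

Lemma fatou_le (F : nat -> T -> R) (f : T -> R) (K : \bar R) :
  (forall n, measurable_fun setT (F n)) -> (forall n x, 0 <= F n x) ->
  (forall x, F n x @[n --> \oo] --> f x) ->
  (forall n, \int[mu]_x (F n x)%:E <= K)%E -> (\int[mu]_x (f x)%:E <= K)%E.
Proof.
move=> mF F0 Ff FK.
have mF' n : measurable_fun setT (EFin \o F n) by exact/measurable_EFinP.
have F0' n x : setT x -> (0 <= (EFin \o F n) x)%E by rewrite lee_fin.
have := fatou mu measurableT mF' F0'.
rewrite (eq_integral (fun x => (f x)%:E)); last first.
  move=> x _; have fx : (EFin \o F n) x @[n --> \oo] --> (f x)%:E.
    by apply: cvg_EFin; [exact: nearW|exact: Ff].
  exact: (cvg_limn_einf_sup fx).1.
move=> /le_trans; apply; rewrite limn_einf_lim; apply: lime_le.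
  exact: is_cvg_einfs.
apply: nearW => n; apply: le_trans (FK n).
by apply: ereal_inf_lbound; exists n => /=.
Qed.

End fatou_bound.

(** * Closure properties of [C]-measurable functions *)

Section measurable_wrt_theory.
Context {d : measure_display} {T : measurableType d} {R : realType}.
Context {C : set (set T)} (hC : is_sub_sigma_algebra C).
Implicit Types f g : T -> R.

Lemma measurable_wrt_cst (c : R) : measurable_wrt C (fun=> c).
Proof. exact/(measurable_wrtP hC). Qed.

Lemma measurable_wrtD f g : measurable_wrt C f -> measurable_wrt C g ->
  measurable_wrt C (fun x => f x + g x).
Proof.
move=> /(measurable_wrtP hC) mf /(measurable_wrtP hC) mg.
by apply/(measurable_wrtP hC); exact: measurable_funD.
Qed.

Lemma measurable_wrtB f g : measurable_wrt C f -> measurable_wrt C g ->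
  measurable_wrt C (fun x => f x - g x).
Proof.
move=> /(measurable_wrtP hC) mf /(measurable_wrtP hC) mg.
by apply/(measurable_wrtP hC); exact: measurable_funB.
Qed.

Lemma measurable_wrtM f g : measurable_wrt C f -> measurable_wrt C g ->
  measurable_wrt C (fun x => f x * g x).
Proof.
move=> /(measurable_wrtP hC) mf /(measurable_wrtP hC) mg.
by apply/(measurable_wrtP hC); exact: measurable_funM.
Qed.

Lemma measurable_wrtX n f : measurable_wrt C f ->
  measurable_wrt C (fun x => f x ^+ n).
Proof.
move=> /(measurable_wrtP hC) mf.
by apply/(measurable_wrtP hC); exact: measurable_funX.
Qed.

Lemma measurable_wrt_norm f : measurable_wrt C f ->
  measurable_wrt C (fun x => `|f x|).
Proof.
move=> /(measurable_wrtP hC) mf.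
by apply/(measurable_wrtP hC); exact: measurableT_comp.
Qed.

Lemma measurable_wrt_div f g : measurable_wrt C f -> measurable_wrt C g ->
  (forall x, 0 < g x) -> measurable_wrt C (fun x => f x / g x).
Proof.
move=> mf /(measurable_wrtP hC) mg g0; apply: measurable_wrtM => //.
apply/(measurable_wrtP hC).
under eq_fun => x do rewrite -powR_inv1 ?(ltW (g0 x))//.
by apply: (@measurableT_comp _ _ _ _ _ _ (@powR R ^~ (-1))).
Qed.

Lemma measurable_wrt_if_le f g (h k : T -> R) :
  measurable_wrt C f -> measurable_wrt C g -> measurable_wrt C h -> measurable_wrt C k ->
  measurable_wrt C (fun x => if f x <= g x then h x else k x).
Proof.
move=> /(measurable_wrtP hC) mf /(measurable_wrtP hC) mg.
move=> /(measurable_wrtP hC) mh /(measurable_wrtP hC) mk.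
apply/(measurable_wrtP hC); apply: measurable_fun_ifT => //.
exact: measurable_fun_ler.
Qed.

End measurable_wrt_theory.

(** * Conditional means for one density and for mixtures of two *)

Section conditional_mean.
Context {d : measure_display} {T : measurableType d} {R : realType}.
Context {P0 : probability T R} {C : set (set T)} (hC : is_sub_sigma_algebra C).
Context {eps : R} (eps01 : 0 < eps < 1).
Context {xi : T -> R} (xiL : Lp P0 (4 + 2 * eps) xi).
Local Notation intg f := (P0.-integrable setT (EFin \o f)).
Local Notation p := (2 + eps).
Local Notation q := (1 + 2 / eps).
Local Notation q' := (1 + eps / 2).
Implicit Types f u a g : T -> R.

Let p0 : 0 < p. Proof. by move/andP : eps01 => [? ?]; lra. Qed.
Let q'0 : 0 < q'. Proof. by move/andP : eps01 => [? ?]; lra. Qed.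
Let q0 : 0 < q.
Proof. by move/andP : eps01 => [e0 _]; rewrite addr_gt0// divr_gt0. Qed.
Let qq' : q^-1 + q'^-1 = 1.
Proof.
move/andP : eps01 => [e0 _]; have : eps != 0 by rewrite gt_eqF.
by move=> ?; field; rewrite !gt_eqF//; lra.
Qed.

Lemma Lq_mul_intg f z : Lp P0 q f -> Lp P0 q' z -> intg (fun x => f x * z x).
Proof. exact: Lp_conj_intg. Qed.

(** Since [2 + eps] is twice [q'], the conjugate exponent of [q], the function [(xi - eta)^2] can be
    integrated against a density in L^q. *)
Lemma Lp_mul_Lq' z w : Lp P0 p z -> Lp P0 p w -> Lp P0 q' (fun x => z x * w x).
Proof.
have -> : p = 2 * q' by field.
exact: Lp_mul.
Qed.

Lemma Lq_intg f : Lp P0 q f -> intg f.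
Proof.
move=> fL; have := Lq_mul_intg fL (Lp_cst 1 q'0).
by under eq_fun do rewrite /= mulr1.
Qed.

Lemma xi_Lp : Lp P0 p xi.
Proof. by apply: Lp_le xiL; rewrite p0/=; move/andP : eps01 => [? ?]; lra. Qed.

Lemma xi_mul_intg f : Lp P0 q f -> intg (fun x => xi x * f x).
Proof.
move=> fL; under eq_fun do rewrite mulrC.
apply: Lq_mul_intg => //; apply: Lp_le xiL.
by move/andP : eps01 => [? ?]; apply/andP; split; lra.
Qed.

Lemma xi4_Lq' : Lp P0 q' (fun x => xi x ^+ 4).
Proof.
have r0 : 0 < 4 + 2 * eps by move/andP : eps01 => [? ?]; lra.
move: xiL => /(LpP _ r0)[mxi xii]; apply/(LpP _ q'0); split.
  exact: measurable_funX.
under eq_fun do rewrite normrX -powR_mulrn// -powRrM.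
by have <- : 4 + 2 * eps = 4%:R * q' by field.
Qed.

(* [u] and [a] are [E[f | C]] and [E[xi * f | C]], so that [a / u] is the
   conditional mean of [xi] under the measure of density [f]. *)
Definition cond_mean_data f u a := [/\ Lp P0 q f, (forall x, 0 <= f x),
  cond_exp_version P0 C f u /\ (forall x, 0 < u x),
  cond_exp_version P0 C (fun x => xi x * f x) a &
  LpC P0 C p (fun x => a x / u x)].

(** The integrals of [|z| * f] and [|z| * u] are equal as extended reals, so one is finite when the
    other is. *)
Lemma cond_exp_intg f u z : measurable_fun setT f -> (forall x, 0 <= f x) ->
  intg f -> cond_exp_version P0 C f u -> (forall x, 0 <= u x) ->
  measurable_wrt C z -> intg (fun x => z x * f x) -> intg (fun x => z x * u x).
Proof.
move=> mf f0 fi [mu ui fu] u0 mz zf.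
have muT := measurable_wrt_measurable hC mu.
have mzT := measurable_wrt_measurable hC mz.
have h := ge0_integral_sub_sigma hC mf f0 fi muT u0 ui
  (fun A CA => esym (fu A CA)) (measurable_wrt_norm hC mz) (fun x => normr_ge0 _).
have mzf : measurable_fun setT (fun x => `|z x| * f x).
  by apply: measurable_funM => //; exact: measurableT_comp.
have mzu : measurable_fun setT (fun x => `|z x| * u x).
  by apply: measurable_funM => //; exact: measurableT_comp.
have zfn : intg (fun x => `|z x| * f x).
  by apply: (intg_le _ _ (intg_norm zf)) => // x; rewrite !normrM normr_id.
have zun : intg (fun x => `|z x| * u x).
  apply/intg_ge0P => //; first by move=> x; rewrite mulr_ge0.
  rewrite -h; apply/intg_ge0P => // x; exact: mulr_ge0.
apply: (intg_le _ _ zun); first exact: measurable_funM.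
by move=> x; rewrite normrM (ger0_norm (u0 x)).
Qed.

(** With [z = m - eta], the residual [xi - m] is orthogonal to the [C]-measurable [z] for the weight
    [f], so the right side exceeds the left by the integral of [f * z^2]. *)
Lemma cond_mean_optimal f u a eta : cond_mean_data f u a -> LpC P0 C p eta ->
  \int[P0]_x (f x * (xi x - a x / u x) ^+ 2) <=
  \int[P0]_x (f x * (xi x - eta x) ^+ 2).
Proof.
move=> [fL f0 [fu u0] fa [mL mC]] [eL eC].
set m := fun x => a x / u x in mL mC *.
pose z x := m x - eta x.
have zL : Lp P0 p z by exact: LpB.
have zC : measurable_wrt C z by exact: measurable_wrtB.
have fi := Lq_intg fL; have mf := intg_meas fi.
have xL := xi_Lp.
have prod (v w : T -> R) : Lp P0 p v -> Lp P0 p w -> intg (fun x => f x * (v x * w x)).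
  by move=> vL wL; apply: Lq_mul_intg => //; exact: Lp_mul_Lq'.
have xmL : Lp P0 p (fun x => xi x - m x) by exact: LpB.
have zxi : intg (fun x => z x * (xi x * f x)).
  by under eq_fun do rewrite mulrA mulrC; exact: prod.
have zmi : intg (fun x => z x * m x * f x).
  by under eq_fun do rewrite mulrC; exact: prod.
have zmC : measurable_wrt C (fun x => z x * m x) by exact: measurable_wrtM.
have zmu : intg (fun x => z x * m x * u x).
  by apply: cond_exp_intg zmi => // x; exact: ltW.
have zaE x : z x * m x * u x = z x * a x.
  by rewrite /m -mulrA divfK// gt_eqF.
have xifi := xi_mul_intg fL.
(* Both sides equal the integral of [z * a]: the left by conditioning [xi * f], the right by
   conditioning [f] and using [m * u = a]. *)
have orth : \int[P0]_x (z x * (xi x * f x)) = \int[P0]_x (z x * m x * f x).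
  rewrite (cond_exp_Rintegral hC xifi fa zC zxi); last first.
    by under eq_fun do rewrite -zaE.
  rewrite (cond_exp_Rintegral hC fi fu zmC zmi zmu).
  by apply: eq_Rintegral => x _; rewrite zaE.
pose w x := z x * (xi x * f x) - z x * m x * f x.
have wi : intg w by exact: intgB.
have w0 : \int[P0]_x (2 * w x) = 0.
  by rewrite RintegralZl// RintegralB// orth subrr mulr0.
have zzi : intg (fun x => f x * (z x * z x)) by exact: prod.
have xmi := prod _ _ xmL xmL.
have -> : \int[P0]_x (f x * (xi x - eta x) ^+ 2) =
    \int[P0]_x (f x * ((xi x - m x) * (xi x - m x))) +
    (\int[P0]_x (f x * (z x * z x)) + \int[P0]_x (2 * w x)).
  rewrite -RintegralD//; last exact: intgZ.
  rewrite -RintegralD//; last by apply: intgD => //; exact: intgZ.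
  by apply: eq_Rintegral => x _; rewrite /w /z; ring.
rewrite w0 addr0; under [leLHS]eq_Rintegral do rewrite expr2.
rewrite lerDl; apply: Rintegral_ge0 => x _.
by rewrite mulr_ge0// -expr2 sqr_ge0.
Qed.

Lemma cond_exp_version_comb (c1 c2 : R) (f1 k1 f2 k2 : T -> R) :
  intg f1 -> intg f2 -> cond_exp_version P0 C f1 k1 -> cond_exp_version P0 C f2 k2 ->
  cond_exp_version P0 C (fun x => c1 * f1 x + c2 * f2 x)
    (fun x => c1 * k1 x + c2 * k2 x).
Proof.
move=> f1i f2i [m1 k1i e1] [m2 k2i e2]; split.
- by apply: measurable_wrtD => //; apply: measurable_wrtM => //;
    exact: measurable_wrt_cst.
- by apply: intgD; exact: intgZ.
- move=> A CA; have mA := hC.2 _ CA.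
  have E (g1 g2 : T -> R) : intg g1 -> intg g2 ->
      (\int[P0]_(x in A) (c1 * g1 x + c2 * g2 x)%:E =
       (c1 * \int[P0]_(x in A) g1 x + c2 * \int[P0]_(x in A) g2 x)%:E)%E.
    move=> g1i g2i; rewrite Rintegral_EFin//; last by apply: intgD; exact: intgZ.
    rewrite RintegralD//; last 2 first.
      by apply: integrableS (intgZ c1 g1i).
      by apply: integrableS (intgZ c2 g2i).
    rewrite !RintegralZl//; first exact: integrableS g2i.
    exact: integrableS g1i.
  by rewrite !E// /Rintegral e1// e2.
Qed.

(** The mixed quotient is a pointwise average of [a1 / u1] and [a2 / u2], with weights proportional
    to [(1 - t) * u1] and [t * u2]. Its absolute value is thus at most the larger of theirs, which
    keeps it in L^p. *)
Lemma cond_mean_data_mix f1 u1 a1 f2 u2 a2 (t : R) : 0 <= t <= 1 ->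
  cond_mean_data f1 u1 a1 -> cond_mean_data f2 u2 a2 ->
  cond_mean_data (fun x => (1 - t) * f1 x + t * f2 x)
    (fun x => (1 - t) * u1 x + t * u2 x) (fun x => (1 - t) * a1 x + t * a2 x).
Proof.
move=> t01 [f1L f10 [fu1 u10] fa1 [m1L m1C]] [f2L f20 [fu2 u20] fa2 [m2L m2C]].
have [t0 t1] := andP t01; have t1' : 0 <= 1 - t by rewrite subr_ge0.
have f1i := Lq_intg f1L; have f2i := Lq_intg f2L.
have u0 x : 0 < (1 - t) * u1 x + t * u2 x.
  by have := u10 x; have := u20 x; have [->|tN0] := eqVneq t 0; nra.
have aC : cond_exp_version P0 C
   (fun x => xi x * ((1 - t) * f1 x + t * f2 x)) (fun x => (1 - t) * a1 x + t * a2 x).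
  have := cond_exp_version_comb (1 - t) t (xi_mul_intg f1L) (xi_mul_intg f2L) fa1 fa2.
  by congr (cond_exp_version _ _ _ _); apply/funext => x; ring.
have uC := cond_exp_version_comb (1 - t) t f1i f2i fu1 fu2.
have mC : measurable_wrt C
    (fun x => ((1 - t) * a1 x + t * a2 x) / ((1 - t) * u1 x + t * u2 x)).
  by apply: measurable_wrt_div => //; [case: aC|case: uC].
split=> //.
- apply: (le_Lp (c := 1) _ _ _ f1L f2L) => // [|x].
    exact: intg_meas (intgD (intgZ (1 - t) f1i) (intgZ t f2i)).
  rewrite mul1r ger0_norm ?addr_ge0 ?mulr_ge0// !ger0_norm//.
  by case: (leP (f1 x) (f2 x)) => ?; nra.
- by move=> x; rewrite addr_ge0// mulr_ge0.
- split=> //; apply: (le_Lp (c := 1) _ _ _ m1L m2L) => // [|x].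
    exact: measurable_wrt_measurable mC.
  rewrite mul1r normrM normfV (gtr0_norm (u0 x)) ler_pdivrMr//.
  have a1E : a1 x = (a1 x / u1 x) * u1 x by rewrite divfK// gt_eqF.
  have a2E : a2 x = (a2 x / u2 x) * u2 x by rewrite divfK// gt_eqF.
  rewrite [in leLHS]a1E [in leLHS]a2E.
  set r1 := a1 x / u1 x; set r2 := a2 x / u2 x.
  apply: (le_trans (ler_normD _ _)).
  rewrite !normrM (ger0_norm t0) (ger0_norm t1') (gtr0_norm (u10 x)).
  rewrite (gtr0_norm (u20 x)) mulrDr; apply: lerD.
    rewrite mulrCA [leRHS]mulrC [leRHS]mulrC; apply: ler_wpM2r.
      by rewrite mulr_ge0// ltW.
    by rewrite le_max lexx.
  rewrite mulrCA; apply: ler_wpM2r; first by rewrite mulr_ge0// ltW.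
  by rewrite le_max lexx orbT.
Qed.

(** The event [g <= 0] lies in [C], and over it [f] has the same integral as [g], which is at most
    0; the event is therefore [P0]-null. The value 1 there is an arbitrary positive choice that
    makes division by the version safe everywhere. *)
Lemma positive_cond_exp_version f g :
  intg f -> (forall x, 0 <= f x) ->
  (forall A, measurable A -> (\int[P0]_(x in A) (f x)%:E = 0)%E -> P0 A = 0%E) ->
  cond_exp_version P0 C f g ->
  cond_exp_version P0 C f (fun x => if g x <= 0 then 1 else g x).
Proof.
move=> fi f0 fP0 [gC gi gf].
have uC : measurable_wrt C (fun x => if g x <= 0 then 1 else g x).
  by apply: measurable_wrt_if_le => //; exact: measurable_wrt_cst.
have muT := measurable_wrt_measurable hC uC.
pose A := g @^-1` `]-oo, 0].
have CA : C A by apply: gC.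
have mA := hC.2 _ CA.
have PA0 : P0 A = 0%E.
  apply: fP0 => //; apply/eqP; rewrite eq_le -{1}gf//; apply/andP; split; last first.
    by apply: integral_ge0 => x _; rewrite lee_fin.
  rewrite Rintegral_EFin// lee_fin.
  rewrite -[leRHS](_ : \int[P0]_(x in A) 0 = 0); last by rewrite Rintegral_cst ?mul0r.
  apply: le_Rintegral => //; first exact: integrableS gi.
  exact: integrableS (intg_cst 0).
split=> //.
- apply: (intg_le _ _ (intgD (intg_cst 1) (intg_norm gi))) => // x.
  by case: ifP => _; rewrite ?normr1 ?lerDl ?lerDr.
- move=> B CB; rewrite -gf//; have mB := hC.2 _ CB; apply: ae_eq_integral => //.
  + exact/measurable_EFinP/measurable_funTS.
  + exact/measurable_EFinP/measurable_funTS/(intg_meas gi).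
  + exists A; split=> // x /= /not_implyP[_ /eqP].
    by rewrite /A/= in_itv/=; case: ifP => // _; rewrite eqxx.
Qed.

(** The difference of the two sides factors into nonnegative terms, whatever the signs of [x] and
    [y]. *)
Lemma quartic_young (x y : R) : x * y ^+ 3 <= 4^-1 * x ^+ 4 + 3 / 4 * y ^+ 4.
Proof.
rewrite -subr_ge0.
have -> : 4^-1 * x ^+ 4 + 3 / 4 * y ^+ 4 - x * y ^+ 3 =
  4^-1 * ((x - y) ^+ 2 * ((x + y) ^+ 2 + 2 * y ^+ 2)) by field.
apply: mulr_ge0; first by rewrite invr_ge0.
apply: mulr_ge0; first exact: sqr_ge0.
by apply: addr_ge0; [exact: sqr_ge0|apply: mulr_ge0 => //; exact: sqr_ge0].
Qed.

Lemma cond_mean_quartic f u a : Lp P0 q f -> (forall x, 0 <= f x) ->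
  cond_exp_version P0 C f u -> (forall x, 0 < u x) ->
  Lp P0 q (fun x => f x / u x) -> cond_exp_version P0 C (fun x => xi x * f x) a ->
  (\int[P0]_x ((a x / u x) ^+ 4)%:E <= (\int[P0]_x (f x / u x * xi x ^+ 4))%:E)%E.
Proof.
move=> fL f0 fu u0 hL fa.
have fi := Lq_intg fL; have mf := intg_meas fi.
have [uC ui _] := fu; have [aC ai _] := fa.
pose m x := a x / u x; pose h x := f x / u x.
have mC : measurable_wrt C m by exact: measurable_wrt_div.
(* Truncating [m] makes all the integrals below finite. Cutting to 0 rather than to the level [n]
   keeps [w^3 * m = w^4] exact. *)
pose w (n : nat) x := if `|m x| <= n%:R then m x else 0.
have wC n : measurable_wrt C (w n).
  by apply: measurable_wrt_if_le => //;
    [exact: measurable_wrt_norm|exact: measurable_wrt_cst|exact: measurable_wrt_cst].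
have w_le n x : `|w n x| <= n%:R.
  by rewrite /w; case: ifP => // _; rewrite normr0.
have wX n k x : `|w n x ^+ k| <= n%:R ^+ k by rewrite normrX lerXn2r ?nnegrE.
have bnd (z k : T -> R) (c : R) : measurable_wrt C z -> (forall x, `|z x| <= c) ->
    intg k -> intg (fun x => z x * k x).
  move=> zC zc ki; apply: (intg_le _ _ (intgZ c (intg_norm ki))).
    apply: measurable_funM; last exact: intg_meas ki.
    exact: measurable_wrt_measurable zC.
  by move=> x; rewrite normrM ler_wpM2r.
have hi : intg h := Lq_intg hL.
have xihi : intg (fun x => xi x * h x) := xi_mul_intg hL.
have xifi := xi_mul_intg fL.
have xi4 : intg (fun x => h x * xi x ^+ 4).
  by apply: Lq_mul_intg => //; exact: xi4_Lq'.
have w4i n : intg (fun x => w n x ^+ 4).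
  have := bnd _ _ _ (measurable_wrtX hC 4 (wC n)) (wX n 4) (intg_cst 1).
  by under eq_fun do rewrite mulr1.
have w4hi n : intg (fun x => w n x ^+ 4 * h x).
  exact: bnd (measurable_wrtX hC 4 (wC n)) (wX n 4) hi.
(* This expresses that [h = f / u] has conditional expectation 1, tested against [w^4]. *)
have Ew n : \int[P0]_x (w n x ^+ 4) = \int[P0]_x (w n x ^+ 4 * h x).
  have zC : measurable_wrt C (fun x => w n x ^+ 4 / u x).
    by apply: measurable_wrt_div => //; exact: measurable_wrtX.
  have E1 x : w n x ^+ 4 / u x * u x = w n x ^+ 4 by rewrite divfK// gt_eqF.
  have E2 x : w n x ^+ 4 / u x * f x = w n x ^+ 4 * h x by rewrite /h; ring.
  have zf : intg (fun x => w n x ^+ 4 / u x * f x) by under eq_fun do rewrite E2.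
  have zu : intg (fun x => w n x ^+ 4 / u x * u x) by under eq_fun do rewrite E1.
  have e := cond_exp_Rintegral hC fi fu zC zf zu.
  rewrite -(eq_Rintegral _ (fun x _ => E1 x)) -e.
  by apply: eq_Rintegral => x _; rewrite E2.
(* This expresses that [xi * h] has conditional expectation [m], tested against [w^3]. *)
have Exi n : \int[P0]_x (w n x ^+ 4) = \int[P0]_x (w n x ^+ 3 * (xi x * h x)).
  have zC : measurable_wrt C (fun x => w n x ^+ 3 / u x).
    by apply: measurable_wrt_div => //; exact: measurable_wrtX.
  have E1 x : w n x ^+ 3 / u x * a x = w n x ^+ 4.
    rewrite mulrAC -mulrA -/(m x) /w; case: ifP => _; last by rewrite !expr0n/= mul0r.
    by rewrite -exprSr.
  have E2 x : w n x ^+ 3 / u x * (xi x * f x) = w n x ^+ 3 * (xi x * h x).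
    by rewrite /h; ring.
  have zf : intg (fun x => w n x ^+ 3 / u x * (xi x * f x)).
    under eq_fun do rewrite E2.
    exact: bnd (measurable_wrtX hC 3 (wC n)) (wX n 3) xihi.
  have zu : intg (fun x => w n x ^+ 3 / u x * a x) by under eq_fun do rewrite E1.
  have e := cond_exp_Rintegral hC xifi fa zC zf zu.
  rewrite -(eq_Rintegral _ (fun x _ => E1 x)) -e.
  by apply: eq_Rintegral => x _; rewrite E2.
have h0 x : 0 <= h x by rewrite divr_ge0// ltW.
(* Young's inequality weighted by [h] bounds the integral of [w^4] by a quarter of the target plus
   three quarters of itself; the latter is finite and is absorbed. *)
have bound n : \int[P0]_x (w n x ^+ 4) <= \int[P0]_x (h x * xi x ^+ 4).
  have : \int[P0]_x (w n x ^+ 3 * (xi x * h x)) <=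
      \int[P0]_x (4^-1 * (h x * xi x ^+ 4) + 3 / 4 * (w n x ^+ 4 * h x)).
    apply: le_Rintegral => //.
    - exact: bnd (measurable_wrtX hC 3 (wC n)) (wX n 3) xihi.
    - by apply: intgD; exact: intgZ.
    - move=> x _; have := ler_wpM2r (h0 x) (quartic_young (xi x) (w n x)).
      by rewrite mulrDl; move: (h0 x) => _; congr (_ <= _); ring.
  rewrite RintegralD//; [|exact: intgZ|exact: intgZ].
  rewrite !RintegralZl// -Exi -Ew; lra.
apply: (@fatou_le _ _ _ _ (fun n x => w n x ^+ 4)).
- move=> n; exact: intg_meas (w4i n).
- by move=> n x; rewrite -[4%N]/(2 * 2)%N exprM sqr_ge0.
- move=> x; apply: cvg_near_cst; near=> n.
  rewrite /w ifT//; near: n; exact: nbhs_infty_ger.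
- by move=> n; rewrite Rintegral_EFin// lee_fin.
Unshelve. all: by end_near. Qed.

Lemma cond_mean_exists f g : Lp P0 q f -> (forall x, 0 <= f x) ->
  (forall A, measurable A -> (\int[P0]_(x in A) (f x)%:E = 0)%E -> P0 A = 0%E) ->
  cond_exp_version P0 C f g -> Lp P0 q (fun x => f x / g x) ->
  exists u a, cond_mean_data f u a.
Proof.
move=> fL f0 fP0 fg hL; have fi := Lq_intg fL.
have fu := positive_cond_exp_version fi f0 fP0 fg.
set u := fun x => if g x <= 0 then 1 else g x in fu.
have u0 x : 0 < u x by rewrite /u; case: (leP (g x) 0).
have [uC _ _] := fu.
have xifi := xi_mul_intg fL.
have [a fa] := cond_exp_exists hC xifi.
exists u, a; split=> //.
have [aC ai _] := fa.
have mC : measurable_wrt C (fun x => a x / u x) by exact: measurable_wrt_div.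
have mT := measurable_wrt_measurable hC mC.
split=> //.
(* Where [u] differs from [g] it equals 1, so [f / u] is either [f] or [f / g], both in L^q. *)
have uL : Lp P0 q (fun x => f x / u x).
  apply: (le_Lp (c := 1) _ _ _ fL hL) => // [|x].
    apply: measurable_funM; first exact: intg_meas fi.
    have := measurable_wrt_div hC (measurable_wrt_cst hC 1) uC u0.
    move=> /(measurable_wrt_measurable hC).
    by under eq_fun do rewrite mul1r.
  rewrite mul1r /u; case: ifP => _; first by rewrite divr1 le_max lexx.
  by rewrite le_max lexx orbT.
have m4 := cond_mean_quartic fL f0 fu u0 uL fa.
have m4i : intg (fun x => (a x / u x) ^+ 4).
  apply/intg_ge0P.
  - exact: measurable_funX.
  - by move=> x; rewrite -[4%N]/(2 * 2)%N exprM sqr_ge0.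
  - by apply: le_lt_trans m4 _; exact: ltry.
(* The inclusion of L^4 in L^{2+eps} uses [eps < 1]. *)
apply: (@Lp_le _ _ _ _ _ 4); first by rewrite p0/=; move/andP : eps01 => [? ?]; lra.
apply/LpP => //; split=> //.
apply: eq_integrable m4i => // x _ /=.
by rewrite powR_mulrn// -normrX ger0_norm// -[4%N]/(2 * 2)%N exprM sqr_ge0.
Qed.

(** Moving slightly from [f1] towards [f2] does not raise the optimal value. Since [a1 / u1] is
    already optimal for [f1], the [f2] part of the mixed cost cannot exceed [s]; then the mixing
    weight tends to 0. *)
Lemma cond_mean_saddle f1 u1 a1 f2 u2 a2 :
  cond_mean_data f1 u1 a1 -> cond_mean_data f2 u2 a2 ->
  (forall t u a, 0 <= t <= 1 ->
     cond_mean_data (fun x => (1 - t) * f1 x + t * f2 x) u a ->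
     \int[P0]_x (((1 - t) * f1 x + t * f2 x) * (xi x - a x / u x) ^+ 2) <=
     \int[P0]_x (f1 x * (xi x - a1 x / u1 x) ^+ 2)) ->
  (\int[P0]_x (f2 x * (xi x - a1 x / u1 x) ^+ 2)%:E <=
   (\int[P0]_x (f1 x * (xi x - a1 x / u1 x) ^+ 2))%:E)%E.
Proof.
move=> D1 D2 le_val.
set s := \int[P0]_x (f1 x * _).
have [f1L f10 [_ u10] _ [m1L m1C]] := D1; have [f2L f20 [_ u20] _ _] := D2.
pose t (n : nat) : R := n.+1%:R^-1.
have t0 n : 0 < t n by rewrite invr_gt0.
have t01 n : 0 <= t n <= 1 by rewrite ltW//= invf_le1// ler1n.
pose m n x := ((1 - t n) * a1 x + t n * a2 x) / ((1 - t n) * u1 x + t n * u2 x).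
have Dn n := cond_mean_data_mix (t01 n) D1 D2.
have mL n : LpC P0 C p (m n) by have [] := Dn n.
have sqi (f eta : T -> R) : Lp P0 q f -> Lp P0 p eta ->
    intg (fun x => f x * (xi x - eta x) ^+ 2).
  move=> fL eL; apply: Lq_mul_intg => //.
  under eq_fun do rewrite expr2.
  by apply: Lp_mul_Lq'; apply: LpB => //; exact: xi_Lp.
have bound n : \int[P0]_x (f2 x * (xi x - m n x) ^+ 2) <= s.
  have [mnL mnC] := mL n.
  have h1 := cond_mean_optimal D1 (mL n).
  have := le_val _ _ _ (t01 n) (Dn n).
  have -> : \int[P0]_x (((1 - t n) * f1 x + t n * f2 x) *
      (xi x - ((1 - t n) * a1 x + t n * a2 x) /
              ((1 - t n) * u1 x + t n * u2 x)) ^+ 2) =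
      (1 - t n) * \int[P0]_x (f1 x * (xi x - m n x) ^+ 2) +
      t n * \int[P0]_x (f2 x * (xi x - m n x) ^+ 2).
    rewrite -!RintegralZl//; [|exact: sqi|exact: sqi].
    rewrite -RintegralD//; [|by apply: intgZ; exact: sqi|by apply: intgZ; exact: sqi].
    by apply: eq_Rintegral => x _; rewrite /m mulrDl !mulrA.
  (* Here [(1 - t) * s + t * I <= s], where [I] is the [f2] cost of [m n]; dividing by [t > 0] gives
     [I <= s]. *)
  rewrite -/s => h2.
  have /andP[_ t1] := t01 n; have t1' : 0 <= 1 - t n by rewrite subr_ge0.
  have h3 := ler_wpM2l t1' h1.
  by rewrite -(ler_pM2l (t0 n)); rewrite -/s in h3; lra.
apply: (@fatou_le _ _ _ _ (fun n x => f2 x * (xi x - m n x) ^+ 2)).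
- by move=> n; apply: intg_meas; apply: sqi => //; have [] := mL n.
- by move=> n x; rewrite mulr_ge0// sqr_ge0.
- move=> x.
  have tc : t n @[n --> \oo] --> (0 : R) by exact: cvg_harmonic.
  have lin (b c : R) : (1 - t n) * b + t n * c @[n --> \oo] --> b.
    suff : (1 - t n) * b + t n * c @[n --> \oo] --> (1 - 0) * b + 0 * c.
      by rewrite subr0 mul1r mul0r addr0.
    apply: cvgD; apply: cvgM; [|exact: cvg_cst|exact: tc|exact: cvg_cst].
    by apply: cvgB; [exact: cvg_cst|exact: tc].
  (* The quotient converges at every point because the limit [u1 x] of the denominators is
     positive. *)
  have mc : m n x @[n --> \oo] --> a1 x / u1 x.
    apply: cvgM; first exact: lin.
    by apply: cvgV; [rewrite gt_eqF|exact: lin].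
  apply: cvgM; first exact: cvg_cst.
  under eq_fun do rewrite expr2; rewrite expr2.
  by apply: cvgM; apply: cvgB => //; exact: cvg_cst.
- move=> n; rewrite Rintegral_EFin// ?lee_fin//.
  by apply: sqi => //; have [] := mL n.
Qed.

End conditional_mean.

(** An infimum of continuous functions is upper semicontinuous, so it attains its maximum on a
    compact set. The maximiser is a cluster point of the filter generated by the superlevel sets
    [B y], which are nested. *)
Lemma compact_max_inf {R : realType} {X : topologicalType} {I : Type}
    (A : set X) (Z : set I) (ev : I -> X -> R) :
  compact A -> A !=set0 -> (forall i, Z i -> continuous (ev i)) ->
  exists2 x, A x & forall y, A y ->
    (ereal_inf [set (ev i y)%:E | i in Z] <= ereal_inf [set (ev i x)%:E | i in Z])%E.
Proof.
move=> cA [x0 Ax0] cev.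
pose J x := ereal_inf [set (ev i x)%:E | i in Z].
pose B y := [set x | A x /\ (J y <= J x)%E].
have FB : ProperFilter (filter_from A B).
  apply: filter_from_proper; last by move=> y Ay; exists y; split.
  apply: filter_from_filter; first by exists x0.
  move=> y z Ay Az; have [yz|/ltW zy] := leP (J y) (J z).
    by exists z => // x [Ax zx]; split; split => //; exact: le_trans zx.
  by exists y => // x [Ax yx]; split; split => //; exact: le_trans yx.
have [|x [Ax clx]] := cA _ FB; first by exists x0 => // x [].
exists x => // y Ay; apply: le_ereal_inf_tmp => _ [i Zi <-].
rewrite leNgt; apply/negP => lt_ev.
have Jy z : (J z <= (ev i z)%:E)%E by apply: ereal_inf_lbound; exists i.
have Jyfin : J y \is a fin_num.
  by rewrite fin_real// (le_lt_trans (Jy y)) ?ltry// andbT (lt_trans _ lt_ev)// ltNyr.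
rewrite -/(J y) -(fineK Jyfin) lte_fin in lt_ev.
(* The open condition [ev i z < J y] holds near the cluster point, so it meets [B y], where
   [J y <= J z <= ev i z]: a contradiction. *)
have nb : nbhs x [set z | ev i z < fine (J y)].
  exact: (cev i Zi x _ (lt_nbhsl lt_ev)).
have [z [[Az yz] /= zlt]] : B y `&` [set z | ev i z < fine (J y)] !=set0.
  by apply: clx => //; exists y.
by have := le_trans yz (Jy z); rewrite -(fineK Jyfin) lee_fin leNgt zlt.
Qed.

(** * Convexity of the set of densities and continuity of the pairing *)

Section densities_convex.
Context {d : measure_display} {T : measurableType d} {R : realType}.
Context {P0 : probability T R}.
Local Notation intg mu f := (mu.-integrable setT (EFin \o f)).

Lemma integral_density (nu : {finite_measure set T -> \bar R}) (h f : T -> R) :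
  is_density P0 nu h -> measurable_fun setT f -> intg P0 (fun x => f x * h x) ->
  intg nu f /\ (\int[nu]_x (f x)%:E = (\int[P0]_x (f x * h x))%:E)%E.
Proof.
move=> hd mf fhi; have [mh h0 _] := hd.
have ge0E (g : T -> R) : measurable_fun setT g -> (forall x, 0 <= g x) ->
    (\int[nu]_x (g x)%:E = \int[P0]_x (g x * h x)%:E)%E.
  by move=> mg g0; rewrite (ge0_integral_density hd)//; exact/measurable_EFinP.
have mn : measurable_fun setT (fun x => `|f x|) by exact: measurableT_comp.
have nhi : intg P0 (fun x => `|f x| * h x).
  apply: (intg_le _ _ (intg_norm fhi)); first exact: measurable_funM.
  by move=> x; rewrite !normrM normr_id.
have ni : intg nu (fun x => `|f x|).
  apply/intg_ge0P => //; rewrite ge0E//.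
  exact: (integrable_lty measurableT nhi).
have fi : intg nu f by apply: intg_le ni.
split=> //.
have si := intgD ni fi.
have shi : intg P0 (fun x => (`|f x| + f x) * h x).
  by under eq_fun do rewrite mulrDl; exact: intgD.
(* A signed [f] is the difference of the nonnegative [|f| + f] and [|f|], to which [ge0E]
   applies. *)
transitivity (\int[nu]_x ((`|f x| + f x) - `|f x|)%:E)%E.
  by apply: eq_integral => x _; rewrite addrC addrA addNr add0r.
rewrite integralB_EFin// !ge0E//; last 2 first.
- exact: measurable_funD.
- by move=> x; have := ler_norm (- f x); rewrite normrN; lra.
rewrite !Rintegral_EFin// -EFinB -RintegralB//.
by congr (_%:E); apply: eq_Rintegral => x _; ring.
Qed.

Lemma integrable_density (nu : {finite_measure set T -> \bar R}) (h f : T -> R) :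
  is_density P0 nu h -> intg nu f -> intg P0 (fun x => f x * h x).
Proof.
move=> hd fi; have [mh h0 _] := hd; have mf := intg_meas fi.
have mn : measurable_fun setT (fun x => `|f x|) by exact: measurableT_comp.
have nhi : intg P0 (fun x => `|f x| * h x).
  apply/intg_ge0P; first exact: measurable_funM.
    by move=> x; rewrite mulr_ge0.
  have /= <- := ge0_integral_density hd (f := fun x => `|f x|%:E).
  - exact: (integrable_lty measurableT (intg_norm fi)).
  - exact/measurable_EFinP.
  - by move=> x; rewrite lee_fin.
apply: (intg_le _ _ nhi); first exact: measurable_funM.
by move=> x; rewrite normrM (ger0_norm (h0 x)).
Qed.

(** Domination by [rho] is, for each [xi], an upper bound on an integral that is affine in the
    density, hence it survives mixing. *)
Lemma densities_repset_convex (p : R) (rho : (T -> R) -> R) (f1 f2 : T -> R) (t : R) :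
  0 <= t <= 1 ->
  densities P0 (repset P0 p rho) f1 -> densities P0 (repset P0 p rho) f2 ->
  densities P0 (repset P0 p rho) (fun x => (1 - t) * f1 x + t * f2 x).
Proof.
move=> /andP[t0 t1] [P1 P1r d1] [P2 P2r d2].
have t1' : 0 <= 1 - t by rewrite subr_ge0.
have [m1 f10 _] := d1; have [m2 f20 _] := d2.
have i1 := density_integrable d1; have i2 := density_integrable d2.
have mf : measurable_fun setT (fun x => (1 - t) * f1 x + t * f2 x).
  exact: intg_meas (intgD (intgZ (1 - t) i1) (intgZ t i2)).
have f0 x : 0 <= (1 - t) * f1 x + t * f2 x by rewrite addr_ge0// mulr_ge0.
pose Q := density_measure P0 mf f0.
have Q1 : Q setT = 1%E.
  rewrite /Q /density_measure Rintegral_EFin//; last by apply: intgD; exact: intgZ.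
  rewrite RintegralD//; [|exact: intgZ|exact: intgZ].
  rewrite !RintegralZl//.
  have E (P : probability T R) (f : T -> R) : is_density P0 P f -> \int[P0]_x f x = 1.
    by move=> [_ _ fE]; rewrite /Rintegral -fE//= probability_setT.
  by rewrite (E _ _ d1) (E _ _ d2); congr (_%:E); ring.
pose Qp : probability T R := HB.pack Q (Measure_isProbability.Build _ _ _ Q Q1).
exists Qp; last by split.
have dQ : is_density P0 Qp (fun x => (1 - t) * f1 x + t * f2 x) by split.
move=> x xL; have mx := Lp_meas xL.
have xi1 := integrable_density d1 (P1r _ xL).1.
have xi2 := integrable_density d2 (P2r _ xL).1.
have E y : x y * ((1 - t) * f1 y + t * f2 y) = (1 - t) * (x y * f1 y) + t * (x y * f2 y).
  by ring.
have xQ : intg P0 (fun y => x y * ((1 - t) * f1 y + t * f2 y)).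
  by under eq_fun do rewrite E; apply: intgD; exact: intgZ.
have [xQi ->] := integral_density dQ mx xQ; split=> //.
have [_] := P1r _ xL; have [_ ->] := integral_density d1 mx xi1.
have [_] := P2r _ xL; have [_ ->] := integral_density d2 mx xi2.
rewrite !lee_fin (eq_Rintegral _ (fun y _ => E y)) RintegralD//;
  [|exact: intgZ|exact: intgZ].
rewrite !RintegralZl// => h2 h1.
have := ler_wpM2l t0 h2; have := ler_wpM2l t1' h1; lra.
Qed.

(** The initial topology makes [pairing] continuous into the pointwise topology, where evaluation at
    [g] is a coordinate projection. *)
Lemma pairing_continuous (q' : R) (g : Ltest P0 q') :
  continuous ((fun f => pairing P0 q' f g) : initial_topology (pairing P0 q') -> R).
Proof.
move=> f; apply: (@continuous_comp (initial_topology (pairing P0 q'))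
  {ptws Ltest P0 q' -> R} R (pairing P0 q') (fun h => h g)).
  exact: initial_continuous.
exact: (@proj_continuous {classic (Ltest P0 q')} (fun=> R) g (pairing P0 q' f)).
Qed.

End densities_convex.

(** * Existence of an optimal estimator *)

Unset Implicit Arguments.

Theorem theorem3 (R : realType) (d : measure_display) (T : measurableType d)
  (P0 : probability T R) (eps : R) (C : set (set T)) (rho : (T -> R) -> R)
  (xi : T -> R) :
  measure_is_complete P0 ->
  0 < eps < 1 ->
  is_sub_sigma_algebra C ->
  sublinear P0 (2 + eps) rho ->
  (* standing assumptions *)
  (forall P, repset P0 (2 + eps) rho P -> equivalent_measures P P0) ->
  (exists M : R, forall h, densities P0 (repset P0 (2 + eps) rho) h ->
     Lp P0 (1 + 2 / eps) h /\ ('N[P0]_((1 + 2 / eps)%:E)[EFin \o h] <= M%:E)%E) ->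
  weakly_compact P0 (1 + eps / 2) (densities P0 (repset P0 (2 + eps) rho)) ->
  (* hypotheses of the theorem *)
  Lp P0 (4 + 2 * eps) xi ->
  stable P0 C (repset P0 (2 + eps) rho) ->
  exists2 eta_hat, LpC P0 C (2 + eps) eta_hat &
    rho_sq (repset P0 (2 + eps) rho) xi eta_hat =
    ereal_inf [set rho_sq (repset P0 (2 + eps) rho) xi eta | eta in LpC P0 C (2 + eps)].
Proof.
move=> _ eps01 hC _ Peq [M DL] cD xiL stab.
set Ps := repset _ _ _ in Peq DL cD stab *.
have p0 : 0 < 2 + eps by move/andP : eps01 => [? ?]; lra.
have q0 : 0 < 1 + 2 / eps.
  by move/andP : eps01 => [e0 _]; rewrite addr_gt0// divr_gt0.
have L0 : LpC P0 C (2 + eps) (cst 0).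
  by split; [exact: Lp_cst|exact: measurable_wrt_cst].
(* Over an empty representation set every supremum is [-oo], and any [eta] is optimal. *)
have [[P1 P1s]|noP] := pselect (Ps !=set0); last first.
  have rhoN eta : rho_sq Ps xi eta = -oo%E.
    rewrite /rho_sq (_ : Ps = set0) ?image_set0 ?ereal_sup0// -subset0 => P PsP.
    by apply: noP; exists P.
  exists (cst 0) => //; rewrite rhoN; apply/esym/eqP; rewrite -leeNy_eq.
  by apply: ereal_inf_lbound; exists (cst 0).
have dens P : Ps P -> exists2 f, is_density P0 P f & densities P0 Ps f.
  move=> Psp; have [|f fd] := @density_exists _ _ _ P0 P.
    by apply/null_content_dominatesP => A mA A0; apply/(Peq _ Psp A mA).
  by exists f => //; exists P.
have sqi f eta : densities P0 Ps f -> LpC P0 C (2 + eps) eta ->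
    Lp P0 (1 + eps / 2) (fun x => (xi x - eta x) ^+ 2) /\
    P0.-integrable setT (EFin \o (fun x => f x * (xi x - eta x) ^+ 2)).
  move=> fD [eL _]; have zL : Lp P0 (1 + eps / 2) (fun x => (xi x - eta x) ^+ 2).
    under eq_fun do rewrite expr2.
    by apply: (Lp_mul_Lq' eps01); apply: LpB => //; exact: xi_Lp xiL.
  by split=> //; apply: (Lq_mul_intg eps01) => //; have [] := DL _ fD.
have EP P f eta : Ps P -> is_density P0 P f -> LpC P0 C (2 + eps) eta ->
    (\int[P]_x ((xi x - eta x) ^+ 2)%:E =
     (\int[P0]_x (f x * (xi x - eta x) ^+ 2))%:E)%E.
  move=> Psp fd eL; have fD : densities P0 Ps f by exists P.
  have [zL zi] := sqi _ _ fD eL.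
  have zi' : P0.-integrable setT (EFin \o (fun x => (xi x - eta x) ^+ 2 * f x)).
    by under eq_fun do rewrite mulrC.
  have [_ ->] := integral_density fd (Lp_meas zL) zi'.
  by congr (_%:E); apply: eq_Rintegral => x _; rewrite mulrC.
(* Stability puts [f / g] among the densities, hence in L^q; equivalence of measures supplies the
   null-set condition. *)
have cmd f : densities P0 Ps f -> exists u a,
    cond_mean_data (P0 := P0) (C := C) (eps := eps) (xi := xi) f u a.
  move=> fD; have [P Psp fd] := fD; have [fL _] := DL _ fD; have [mf f0 fE] := fd.
  have [g [fg fgD]] := stab _ Psp _ fd.
  apply: (cond_mean_exists hC eps01 xiL fL f0 _ fg); last by have [] := DL _ fgD.
  by move=> A mA fA; apply/(Peq _ Psp A mA); rewrite fE.
(* For fixed [eta] this is the pairing of [f] with [(xi - eta)^2], hence weakly continuous in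
   [f]. *)
pose ev (eta : {eta | LpC P0 C (2 + eps) eta}) (f : T -> R) :=
  \int[P0]_x (f x * (xi x - sval eta x) ^+ 2).
have cev eta : setT eta -> continuous
    (ev eta : initial_topology (pairing P0 (1 + eps / 2)) -> R).
  move=> _; have [f1 _ f1D] := dens _ P1s.
  have [zL _] := sqi _ _ f1D (svalP eta).
  exact: (@pairing_continuous _ _ _ P0 _ (exist _ _ zL)).
have [|fh fhD fmax] := compact_max_inf cD _ cev.
  by have [f _ fD] := dens _ P1s; exists f.
(* The infimum over [eta] is attained at the conditional mean. *)
have JE f u a : cond_mean_data (P0 := P0) (C := C) (eps := eps) (xi := xi) f u a ->
    ereal_inf [set (ev i f)%:E | i in setT] =
    (\int[P0]_x (f x * (xi x - a x / u x) ^+ 2))%:E.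
  move=> D; have [_ _ _ _ mL] := D; apply/eqP; rewrite eq_le; apply/andP; split.
    by apply: ereal_inf_lbound; exists (exist _ _ mL).
  apply: le_ereal_inf_tmp => _ [[eta eL] _ <-]; rewrite lee_fin.
  exact: (cond_mean_optimal hC eps01 xiL D eL).
have [uh [ah Dh]] := cmd _ fhD; have [Ph Phs fhd] := fhD.
have mhL : LpC P0 C (2 + eps) (fun x => ah x / uh x) by have [] := Dh.
exists (fun x => ah x / uh x) => //.
have upper : (rho_sq Ps xi (fun x => ah x / uh x)%R <=
    (\int[P0]_x (fh x * (xi x - ah x / uh x) ^+ 2))%:E)%E.
  apply: ge_ereal_sup => _ [P Psp <-]; have [f fd fD] := dens _ Psp.
  have [u [a D]] := cmd _ fD; have [fL _] := DL _ fD.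
  rewrite (EP _ f)// -Rintegral_EFin//; last by have [] := sqi _ _ fD mhL.
  (* The mixture is again a density of the representation set, so maximality of [fh] gives the
     hypothesis on optimal values. *)
  apply: (cond_mean_saddle hC eps01 xiL Dh D) => t ut at_ t01 Dt.
  rewrite -lee_fin -(JE _ _ _ Dh) -(JE _ _ _ Dt); apply: fmax.
  exact: densities_repset_convex.
apply/eqP; rewrite eq_le; apply/andP; split.
  (* For any [eta], the worst case is at least the cost under [Ph], which is at least the optimal
     value for [fh]. *)
  apply: le_ereal_inf_tmp => _ [eta eL <-]; apply: le_trans upper _.
  apply: (@le_trans _ _ (\int[Ph]_x ((xi x - eta x) ^+ 2)%:E)%E).
    by rewrite (EP _ fh)// lee_fin; exact: (cond_mean_optimal hC eps01 xiL Dh eL).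
  by apply: ereal_sup_ubound; exists Ph.
by apply: ereal_inf_lbound; exists (fun x => ah x / uh x).
Qed.
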